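(* Let $\bm{H}$ be a random matrix with values in $\mathbb{C}^{N_R\times N_T}$, $p$ a nonnegative random variable (random transmit power), $\lambda_{\max}$ the maximum eigenvalue of $\bm{H}\bm{H}^\ast$, and $c=W\log_2\det(\bm{I}_{N_R}+\frac{1}{N_TN_0W}p\bm{H}\bm{H}^\ast)$ with constants $W,N_0>0$. Consider the conditions (each with ''for some $\theta>0$''): (0) $\mathbb{E}[(1+p\lambda_{\max})^\theta]<\infty$; (1) $\mathbb{E}[(1+p\operatorname{Tr}[\bm{H}\bm{H}^\ast])^\theta]<\infty$; (2) $\mathbb{E}[(\operatorname{Tr}[\bm{I}+p\bm{H}\bm{H}^\ast])^\theta]<\infty$; (3) $\mathbb{E}[(\operatorname{Tr}[e^{p\bm{H}\bm{H}^\ast}])^\theta]<\infty$; (4) $\mathbb{E}[e^{\theta p\lambda_{\max}}]<\infty$; (5) $\mathbb{E}[\operatorname{Tr}[e^{\theta p\bm{H}\bm{H}^\ast}]]<\infty$; (6) $\mathbb{E}[(p\lambda_{\max})^\theta]<\infty$; (7) $\mathbb{E}[e^{\theta p\operatorname{Tr}[\bm{H}\bm{H}^\ast]}]<\infty$. Then (0)$\iff$(1), (2)$\Rightarrow$(1), (3)$\Rightarrow$(2), (4)$\Rightarrow$(1), (5)$\Rightarrow$(4), (0)$\iff$(6), (4)$\iff$(7), and each of these conditions is sufficient for the distribution of $c$ to be light-tailed.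
   Context: A nonnegative random variable $X$ is light-tailed if $\Pr(X>x)=O(e^{-\theta x})$ for some $\theta>0$, equivalently $\mathbb{E}[e^{\theta X}]<\infty$ for some $\theta>0$. $e^{\bm{A}}$ denotes the matrix exponential. *)

(* Defs.v *)
From HB Require Import structures.
From mathcomp Require Import all_boot all_order all_algebra.
From mathcomp Require Import all_classical all_reals all_analysis.
From mathcomp Require Import complex.

Set Implicit Arguments.
Unset Strict Implicit.
Unset Printing Implicit Defensive.
Import Order.TTheory GRing.Theory Num.Theory.
Import numFieldNormedType.Exports.
Local Open Scope classical_set_scope.

(* Equip R[i] with its standard normed-field topology (norm = modulus),
   as MathComp-Analysis does generically for numFieldTypes. *)
HB.instance Definition _ (R : realType) := NormedModule.copy R[i] (R[i])^o.
Local Open Scope ring_scope.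

Definition conjTmx (R : rcfType) (m n : nat) (A : 'M[R[i]]_(m, n)) : 'M[R[i]]_(n, m) :=
  map_mx (@conjc R) A^T.

Definition mxexp (R : realType) (n : nat) (A : 'M[R[i]]_n) : 'M[R[i]]_n :=
  \matrix_(i, j) limn (fun m : nat => \sum_(k < m) (A ^+ k) i j / (k`!)%:R).

(* Maximum eigenvalue of a Hermitian matrix (whose eigenvalues are all real):
   the supremum of the real numbers x such that x is an eigenvalue of M. *)
Definition lambda_max (R : realType) (n : nat) (M : 'M[R[i]]_n) : R :=
  sup [set x : R | eigenvalue M (x%:C)%C].

(* Real part of the trace (the traces occurring below are traces of
   Hermitian matrices, hence real). *)
Definition retr (R : realType) (n : nat) (M : 'M[R[i]]_n) : R := complex.Re (\tr M).

Definition log2 (R : realType) (x : R) : R := ln x / ln 2.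

(* E[f] < oo for a nonnegative function f *)
Definition finite_mean (d : measure_display) (T : measurableType d) (R : realType)
  (P : probability T R) (f : T -> R) : Prop :=
  (\int[P]_t (f t)%:E < +oo)%E.

Definition light_tailed (d : measure_display) (T : measurableType d) (R : realType)
  (P : probability T R) (X : T -> R) : Prop :=
  exists theta : R, 0 < theta /\
  exists C : R, exists x0 : R, forall x : R, x0 <= x ->
    (P [set t | (x < X t)%R] <= (C * expR (- (theta * x)))%:E)%E.

Definition gram (R : rcfType) (NR NT : nat) (H : 'M[R[i]]_(NR, NT)) : 'M[R[i]]_NR :=
  H *m conjTmx H.

(* c = W log2 det(I_{N_R} + (1/(N_T N_0 W)) p H H^* )   (the determinant is real
   and positive for p >= 0; we take its real part) *)
Definition capacity (R : realType) (NR NT : nat) (W N0 : R)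
  (H : 'M[R[i]]_(NR, NT)) (p : R) : R :=
  W * log2 (complex.Re (\det (1%:M + ((p / (NT%:R * N0 * W))%:C)%C *: gram H))).

(* Main.v *)
(** Let G be the Gram matrix of H.  By the spectral theorem G has real eigenvalues
    [d_i >= 0], so that [lambda_max <= Tr G <= N_R lambda_max] and
    [Tr e^(s G) = sum_i e^(s d_i)], which dominates both [e^(s lambda_max)] and
    [Tr (I + s G)].  All implications then follow by pointwise comparison, after
    dividing [theta] by a constant when an exponential of [lambda_max] has to
    dominate one of the trace.  Finally
    [det (I + s G) = prod_i (1 + s d_i) <= (1 + s Tr G)^N_R], so (1) bounds an
    exponential moment of [c], and the Chernoff bound applies.

    The functions built from [lambda_max] are never shown to be measurable: they
    are only compared with measurable functions of the trace. *)
Require Import Defs.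
From HB Require Import structures.
From mathcomp Require Import all_boot all_order all_algebra.
From mathcomp Require Import all_classical all_reals all_analysis.
From mathcomp Require Import complex measurable_realfun.
From mathcomp Require Import ring lra.
Import Order.TTheory GRing.Theory Num.Theory.
Import numFieldNormedType.Exports.
Local Open Scope classical_set_scope.
Local Open Scope ring_scope.
Set Implicit Arguments.
Unset Strict Implicit.
Unset Printing Implicit Defensive.

(** * Diagonalization of Gram matrices and its algebraic consequences *)

Section spectral.
Context (R : realType).
Implicit Types n : nat.

(** Trace, determinant, eigenvalues and powers are similarity invariants or follow conjugation, so
    [U] is only asked to be invertible. The values [d i] are real and listed with multiplicity. *)
Definition diagonalizes n (U : 'M[R[i]]_n) (d : 'I_n -> R) (A : 'M[R[i]]_n) :=
  U \in unitmx /\ A = invmx U *m diag_mx (\row_i ((d i)%:C)%C) *m U.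

(** A Gram matrix is Hermitian, hence normal, hence unitarily diagonalizable. Its diagonal form is
    the Gram matrix of [U *m H], so each diagonal entry is a sum of squared moduli. *)
Lemma gram_diagonalizable n m (H : 'M[R[i]]_(n, m)) :
  exists U d, (forall i, 0 <= d i) /\ diagonalizes U d (gram H).
Proof.
have tconj (k l : nat) (B : 'M[R[i]]_(k, l)) : conjTmx B = map_mx Num.conj B^T by [].
have nG : gram H \is normalmx.
  apply/normalmxP; suff -> : map_mx Num.conj (gram H)^T = gram H by [].
  by rewrite /gram tconj trmx_mul map_mxM trmxCK.
have /orthomx_spectralP Geq := nG.
have Uu := spectral_unit (gram H).
have Uinv := invmx_unitary (spectral_unitarymx (gram H)).
set U := spectralmx (gram H) in Geq Uu Uinv.
set D := spectral_diag (gram H) in Geq.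
have DE : diag_mx D = (U *m H) *m map_mx Num.conj (U *m H)^T.
  rewrite trmx_mul map_mxM -Uinv mulmxA -[U *m H *m _]mulmxA -tconj -/(gram H).
  by rewrite [in RHS]Geq !mulmxA mulmxV// mul1mx mulmxK.
have D0 i : 0 <= D 0 i.
  have -> : D 0 i = (diag_mx D) i i by rewrite mxE eqxx.
  rewrite DE mxE; apply: sumr_ge0 => j _.
  rewrite [X in _ * X]mxE [X in _ * Num.conj X]mxE; exact: mul_conjC_ge0.
clearbody U D; exists U, (fun i => complex.Re (D 0 i)); split.
  by move=> i; have := D0 i; rewrite lecE => /andP[].
suff dE : \row_i ((complex.Re (D 0 i))%:C)%C = D.
  by split; [exact: Uu | rewrite dE; exact: Geq].
apply/rowP => i; rewrite mxE; have := D0 i; rewrite lecE => /andP[/eqP + _].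
by case: (D 0 i) => a b /= ->.
Qed.

Lemma diagonalizes_scale n (U : 'M[R[i]]_n) d A (s : R) :
  diagonalizes U d A -> diagonalizes U (fun i => s * d i) (s%:C%C *: A).
Proof.
move=> [Uu ->]; split=> //; rewrite scalemxAl scalemxAr; congr (_ *m _ *m _).
rewrite -linearZ/=; congr diag_mx; apply/rowP => i.
by rewrite !mxE rmorphM.
Qed.

Lemma retr_diagonalizes n (U : 'M[R[i]]_n) d A :
  diagonalizes U d A -> retr A = \sum_i d i.
Proof.
move=> [Uu ->]; rewrite /retr mxtrace_mulC mulmxA mulmxV// mul1mx mxtrace_diag.
rewrite (eq_bigr (fun i => ((d i)%:C)%C)); last by move=> i _; rewrite mxE.
by rewrite -rmorph_sum.
Qed.

Lemma det1D_diagonalizes n (U : 'M[R[i]]_n) d A :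
  diagonalizes U d A -> complex.Re (\det (1%:M + A)) = \prod_i (1 + d i).
Proof.
move=> [Uu ->].
have -> : 1%:M + invmx U *m diag_mx (\row_i ((d i)%:C)%C) *m U =
  invmx U *m diag_mx (\row_i ((1 + d i)%:C)%C) *m U.
  have -> : diag_mx (\row_i ((1 + d i)%:C)%C) =
      1%:M + diag_mx (\row_i ((d i)%:C)%C).
    by apply/matrixP => i j; rewrite !mxE -mulrnDl rmorphD.
  by rewrite mulmxDr mulmxDl mulmx1 mulVmx.
rewrite !det_mulmx det_inv mulrAC mulVr ?mul1r -?unitmxE// det_diag.
rewrite (eq_bigr (fun i => ((1 + d i)%:C)%C)); last by move=> i _; rewrite mxE.
by rewrite -rmorph_prod.
Qed.

Lemma eigenvalue_diagonalizes n (U : 'M[R[i]]_n) d A (x : R) :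
  diagonalizes U d A -> eigenvalue A (x%:C)%C <-> exists i, d i = x.
Proof.
move=> [Uu ->]; split.
  move=> /eigenvalueP[v /(congr1 (fun w => w *m invmx U)) vA v0].
  rewrite !mulmxA mulmxK// -scalemxAl in vA.
  (* In the coordinates given by [U] the eigenvector equation is diagonal; any nonzero coordinate of
     the eigenvector identifies the eigenvalue with some [d i]. *)
  have /rV0Pn[i wi] : v *m invmx U != 0.
    apply: contra v0 => /eqP w0.
    by rewrite -(mulmxKV Uu v) w0 mul0mx.
  move: (v *m invmx U) vA wi => w vA wi.
  exists i; move/rowP : vA => /(_ i); rewrite mul_mx_diag !mxE mulrC.
  by move/(mulIf wi)/complexI.
(* Eigenvectors are row vectors here, so row [i] of [U] is one for [d i]; it is nonzero because [U]
   is invertible. *)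
move=> [i <-]; apply/eigenvalueP; exists (row i U).
  rewrite !mulmxA -row_mul mulmxV// -!row_mul mul1mx.
  by apply/rowP => j; rewrite row_mul row_diag_mx -scalemxAl -rowE !mxE.
apply/eqP => Ui0; have : row i (U *m invmx U) = 0 by rewrite row_mul Ui0 mul0mx.
rewrite mulmxV// => /rowP/(_ i); rewrite !mxE eqxx => /eqP.
by rewrite oner_eq0.
Qed.

Lemma diagonalizes_exp n (U : 'M[R[i]]_n) d A k :
  diagonalizes U d A -> diagonalizes U (fun i => d i ^+ k) (A ^+ k).
Proof.
move=> [Uu ->]; split=> //; elim: k => [|k IH].
  have -> : diag_mx (\row_i ((d i ^+ 0)%:C)%C) = 1%:M :> 'M[R[i]]_n.
    by apply/matrixP => i j; rewrite !mxE expr0.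
  by rewrite mulmx1 mulVmx.
have -> : diag_mx (\row_i ((d i ^+ k.+1)%:C)%C) =
    diag_mx (\row_i ((d i)%:C)%C) *m diag_mx (\row_i ((d i ^+ k)%:C)%C).
  rewrite mulmx_diag; congr diag_mx; apply/rowP => i.
  by rewrite !mxE exprS rmorphM.
by rewrite exprS IH -mulmxE !mulmxA mulmxK.
Qed.

End spectral.

(** * The maximum eigenvalue and the matrix exponential in terms of the diagonal values *)

Section spectral_consequences.
Context (R : realType).

Section lambda_max.
Variables (n : nat) (U A : 'M[R[i]]_n) (d : 'I_n -> R).
Hypotheses (UdA : diagonalizes U d A) (d_ge0 : forall i, 0 <= d i).

(** This makes the supremum in [lambda_max] a genuine one. *)
Let eigenvalues_le_sum : ubound [set x : R | eigenvalue A (x%:C)%C] (\sum_i d i).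
Proof.
move=> x /(eigenvalue_diagonalizes _ UdA)[i <-].
by rewrite (bigD1 i)//= lerDl sumr_ge0.
Qed.

Lemma le_lambda_max i : d i <= lambda_max A.
Proof.
apply: ub_le_sup; first by exists (\sum_i d i).
by apply/(eigenvalue_diagonalizes _ UdA); exists i.
Qed.

Lemma lambda_max_le_retr : lambda_max A <= retr A.
Proof.
rewrite (retr_diagonalizes UdA) /lambda_max.
(* For [n = 0] there is no eigenvalue, and the supremum of the empty set is 0 by convention. *)
have [E0|/set0P E0] := eqVneq [set x : R | eigenvalue A (x%:C)%C] set0.
  by rewrite E0 sup0 sumr_ge0.
exact: ge_sup.
Qed.

Lemma lambda_max_ge0 : 0 <= lambda_max A.
Proof.
have [E0|/set0P[x Ex]] := eqVneq [set x : R | eigenvalue A (x%:C)%C] set0.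
  by rewrite /lambda_max E0 sup0.
have [i _] := (eigenvalue_diagonalizes _ UdA).1 Ex.
exact: le_trans (le_lambda_max i).
Qed.

Lemma retr_le_lambda_max : retr A <= n%:R * lambda_max A.
Proof.
rewrite (retr_diagonalizes UdA) mulr_natl -[X in _ *+ X]card_ord -sumr_const.
by apply: ler_sum => i _; exact: le_lambda_max.
Qed.

Lemma lambda_max_eigenvalue : (0 < n)%N -> exists i, lambda_max A = d i.
Proof.
move=> n0; have [i _ dmax] := @arg_maxP _ _ _ (Ordinal n0) xpredT d isT.
exists i; apply/eqP; rewrite eq_le le_lambda_max andbT.
apply: ge_sup; first by exists (d i); apply/(eigenvalue_diagonalizes _ UdA); exists i.
by move=> x /(eigenvalue_diagonalizes _ UdA)[j <-]; exact: dmax.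
Qed.

End lambda_max.

Lemma cvg_real_complex (u : R^nat) (l : R) : u @ \oo --> l ->
  (fun k => ((u k)%:C)%C) @ \oo --> ((l%:C)%C : R[i]).
Proof.
move=> ul; apply/cvgrPdist_lt => /= -[e e'].
(* A positive element of [R[i]] has zero imaginary part, so the tolerance is real. *)
rewrite ltcE/= => /andP[/eqP-> e0].
move/cvgrPdist_lt : ul => /(_ _ e0); apply: filterS => k lk.
by rewrite -rmorphB/= normc_def/= expr0n addr0 sqrtr_sqr ltcR.
Qed.

(** Since powers are diagonalized by the same [U], each entry of a partial sum is a fixed finite
    linear combination of partial sums of the scalar exponential series at the [d l], and the limit
    can be taken term by term. *)
Lemma diagonalizes_mxexp n (U A : 'M[R[i]]_n) d :
  diagonalizes U d A -> diagonalizes U (fun i => expR (d i)) (mxexp A).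
Proof.
move=> UdA; split; first exact: UdA.1.
apply/matrixP => i j; rewrite mxE; apply/cvg_lim => //.
have -> : (fun m => \sum_(k < m) (A ^+ k) i j / (k`!)%:R) =
   (fun m => \sum_l invmx U i l * ((series (exp_coeff (d l)) m)%:C)%C * U l j).
  apply/funext => m; under [RHS]eq_bigr => l _.
    rewrite /series/= big_mkord rmorph_sum/= mulr_sumr mulr_suml.
    over.
  rewrite exchange_big/=; apply: eq_bigr => k _.
  rewrite (diagonalizes_exp k UdA).2 mxE mulr_suml; apply: eq_bigr => l _.
  rewrite mul_mx_diag !mxE /exp_coeff/= fmorph_div rmorph_nat; ring.
rewrite mxE; apply: cvg_big; first exact: add_continuous.
move=> l _; rewrite mul_mx_diag !mxE.
apply: cvgMr_tmp; apply: cvgMl_tmp; apply: cvg_real_complex.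
exact: is_cvg_series_exp_coeff.
Qed.

End spectral_consequences.

(** * Comparison of means and the Chernoff bound *)

Section finite_mean.
Context (R : realType) (d : measure_display) (T : measurableType d).
Variable P : probability T R.

Import HBNNSimple.

(* [f] is not assumed measurable, so [ge0_le_integral] does not apply. *)
Lemma finite_mean_le (g f : T -> R) : (forall t, 0 <= g t <= f t) ->
  finite_mean P f -> finite_mean P g.
Proof.
move=> gf; rewrite /finite_mean; apply: le_lt_trans.
rewrite !ge0_integralTE; last 2 first.
- by move=> t; rewrite lee_fin; have /andP[+ ?] := gf t; move/le_trans; apply.
- by move=> t; rewrite lee_fin; have /andP[] := gf t.
apply: ereal_sup_le => _ [h hg <-].
exists h => //= t; apply: le_trans (hg t) _.
by rewrite lee_fin; have /andP[] := gf t.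
Qed.

(** Linearity of the integral cannot be applied to [a * f t + b], as [f] may fail to be measurable.
    Solving the bound for [f] gives a measurable [h] with [h <= f] and [g <= (a + 1) * h + b], and
    linearity is applied to [h]. *)
Lemma finite_mean_le_affine (g f : T -> R) (a b : R) :
  measurable_fun setT g -> 0 <= a -> 0 <= b -> (forall t, 0 <= f t) ->
  (forall t, 0 <= g t <= a * f t + b) ->
  finite_mean P f -> finite_mean P g.
Proof.
move=> mg a0 b0 f0 gf fmf.
(* Dividing by [a + 1] instead of [a] covers [a = 0]. *)
pose h t := Num.max 0 ((g t - b) / (a + 1)).
have a1 : 0 < a + 1 by rewrite ltr_wpDl.
have h0 t : 0 <= h t by rewrite le_max lexx.
have mh : measurable_fun setT h.
  apply: measurable_maxr => //; apply: measurable_funM => //.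
  exact: measurable_funB.
have : finite_mean P h.
  apply: finite_mean_le fmf => t; rewrite h0 ge_max f0 /= ler_pdivrMr//.
  have /andP[_] := gf t; have := f0 t; nra.
rewrite /finite_mean => hfin.
have Dfin : (\int[P]_t ((a + 1)%:E * (h t)%:E + b%:E) < +oo)%E.
  rewrite ge0_integralD//=; last 2 first.
  - by move=> t _; rewrite -EFinM lee_fin mulr_ge0// ltW.
  - by apply/measurable_EFinP; exact: measurable_funM.
  rewrite ge0_integralZl_EFin//=; last 3 first.
  - by move=> t _; rewrite lee_fin.
  - exact/measurable_EFinP.
  - exact: ltW.
  rewrite integral_cst//= probability_setT mule1 lte_add_pinfty ?ltry//.
  by rewrite lte_mul_pinfty ?lee_fin ?ltW.
apply: le_lt_trans Dfin; apply: ge0_le_integral => //=.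
- by move=> t _; rewrite lee_fin; have /andP[] := gf t.
- exact/measurable_EFinP.
- apply: emeasurable_funD => //.
  by apply/measurable_EFinP; exact: measurable_funM.
- move=> t _; rewrite lee_fin -lerBlDr mulrC -ler_pdivrMr//.
  by rewrite le_max lexx orbT.
Qed.

Lemma light_tailed_of_mgf (X : T -> R) (r : R) : measurable_fun setT X -> 0 < r ->
  finite_mean P (fun t => expR (r * X t)) -> light_tailed P X.
Proof.
move=> mX r0; rewrite /finite_mean => Mfin.
pose Y : {RV P >-> R} := mfun_Sub (mem_set mX).
exists r; split=> //; exists (fine (\int[P]_t (expR (r * X t))%:E)), 0 => x _.
(* The tail in [light_tailed] is strict, whereas [chernoff] bounds the weak one. *)
apply: (@le_trans _ _ (P [set t | x <= Y t])).
  apply: le_measure; rewrite ?inE.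
  - rewrite (_ : mkset _ = setT `&` X @^-1` `]x, +oo[%classic).
      exact: (mX measurableT).
    by rewrite setTI; apply/seteqP; split=> t /=; rewrite in_itv/= andbT.
  - rewrite (_ : mkset _ = setT `&` X @^-1` `[x, +oo[%classic).
      exact: (mX measurableT).
    by rewrite setTI; apply/seteqP; split=> t /=; rewrite in_itv/= andbT.
  - by move=> t /= /ltW.
apply: le_trans (chernoff Y x r0) _.
rewrite EFinM fineK; last first.
  by rewrite ge0_fin_numE// integral_ge0// => t _; rewrite lee_fin expR_ge0.
by rewrite /mmt_gen_fun unlock/=; under eq_integral do rewrite mulrC.
Qed.

End finite_mean.

(** * Measurability of traces, determinants and the capacity *)

Section complex_measurable.
Context (R : realType) (d : measure_display) (T : measurableType d).

(** Componentwise measurability is the form in which [theorem6] assumes it for the entries of [H];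
    it is stable under conjugation, sums and products. *)
Definition cmeasurable (f : T -> R[i]) :=
  measurable_fun setT (fun t => complex.Re (f t)) /\
  measurable_fun setT (fun t => complex.Im (f t)).

Lemma cmeasurable_cst (z : R[i]) : cmeasurable (fun=> z).
Proof. by split; exact: measurable_cst. Qed.

Lemma cmeasurable_real (f : T -> R) :
  measurable_fun setT f -> cmeasurable (fun t => ((f t)%:C)%C).
Proof. by split => //=; exact: measurable_cst. Qed.

Lemma cmeasurable_conj (f : T -> R[i]) :
  cmeasurable f -> cmeasurable (fun t => conjc (f t)).
Proof.
move=> [mr mi]; split.
  by rewrite (_ : (fun _ => _) = fun t => complex.Re (f t))//; apply/funext => t; case: (f t).
rewrite (_ : (fun _ => _) = fun t => - complex.Im (f t)).
  exact: measurable_funN.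
by apply/funext => t; case: (f t).
Qed.

Lemma cmeasurableD (f g : T -> R[i]) :
  cmeasurable f -> cmeasurable g -> cmeasurable (fun t => f t + g t).
Proof.
move=> [fr fi] [gr gi]; split.
  rewrite (_ : (fun _ => _) = fun t => complex.Re (f t) + complex.Re (g t)).
    exact: measurable_funD.
  by apply/funext => t; case: (f t) (g t) => [? ?] [].
rewrite (_ : (fun _ => _) = fun t => complex.Im (f t) + complex.Im (g t)).
  exact: measurable_funD.
by apply/funext => t; case: (f t) (g t) => [? ?] [].
Qed.

Lemma cmeasurableM (f g : T -> R[i]) :
  cmeasurable f -> cmeasurable g -> cmeasurable (fun t => f t * g t).
Proof.
move=> [fr fi] [gr gi]; split.
  rewrite (_ : (fun _ => _) = fun t => complex.Re (f t) * complex.Re (g t) -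
      complex.Im (f t) * complex.Im (g t)).
    by apply: measurable_funB; exact: measurable_funM.
  by apply/funext => t; case: (f t) (g t) => [? ?] [].
rewrite (_ : (fun _ => _) = fun t => complex.Re (f t) * complex.Im (g t) +
    complex.Im (f t) * complex.Re (g t)).
  by apply: measurable_funD; exact: measurable_funM.
by apply/funext => t; case: (f t) (g t) => [? ?] [].
Qed.

Lemma cmeasurable_sum (I : Type) (s : seq I) (F : I -> T -> R[i]) :
  (forall i, cmeasurable (F i)) -> cmeasurable (fun t => \sum_(i <- s) F i t).
Proof.
move=> mF; elim: s => [|x s IH].
  by under eq_fun do rewrite big_nil; exact: cmeasurable_cst.
by under eq_fun do rewrite big_cons; exact: cmeasurableD.
Qed.

Lemma cmeasurable_prod (I : Type) (s : seq I) (F : I -> T -> R[i]) :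
  (forall i, cmeasurable (F i)) -> cmeasurable (fun t => \prod_(i <- s) F i t).
Proof.
move=> mF; elim: s => [|x s IH].
  by under eq_fun do rewrite big_nil; exact: cmeasurable_cst.
by under eq_fun do rewrite big_cons; exact: cmeasurableM.
Qed.

Lemma cmeasurable_det n (M : T -> 'M[R[i]]_n) :
  (forall i j, cmeasurable (fun t => M t i j)) -> cmeasurable (fun t => \det (M t)).
Proof.
move=> mM; apply: cmeasurable_sum => s; apply: cmeasurableM.
  exact: cmeasurable_cst.
by apply: cmeasurable_prod => i; exact: mM.
Qed.

Lemma cmeasurable_gram n m (H : T -> 'M[R[i]]_(n, m)) :
  (forall i j, cmeasurable (fun t => H t i j)) ->
  forall i j, cmeasurable (fun t => gram (H t) i j).
Proof.
move=> mH i j; under eq_fun do rewrite mxE.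
apply: cmeasurable_sum => k; apply: cmeasurableM; first exact: mH.
by under eq_fun do rewrite !mxE; exact: cmeasurable_conj.
Qed.

Lemma measurable_retr n (M : T -> 'M[R[i]]_n) :
  (forall i j, cmeasurable (fun t => M t i j)) ->
  measurable_fun setT (fun t => retr (M t)).
Proof.
by move=> mM; have [] : cmeasurable (fun t => \tr (M t)) by exact: cmeasurable_sum.
Qed.

Lemma measurable_capacity n m (W N0 : R) (H : T -> 'M[R[i]]_(n, m)) (p : T -> R) :
  (forall i j, cmeasurable (fun t => H t i j)) -> measurable_fun setT p ->
  measurable_fun setT (fun t => capacity W N0 (H t) (p t)).
Proof.
move=> mH mp; rewrite /capacity /log2; apply: measurable_funM => //.
apply: measurable_funM => //; apply: measurableT_comp => //.
suff [] : cmeasurable (fun t => \det (1%:M + ((p t / (m%:R * N0 * W))%:C)%C *: gram (H t))) by [].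
apply: cmeasurable_det => i j; under eq_fun do rewrite mxE [X in _ + X]mxE.
apply: cmeasurableD; first exact: cmeasurable_cst.
apply: cmeasurableM; last exact: cmeasurable_gram.
by apply: cmeasurable_real; exact: measurable_funM.
Qed.

End complex_measurable.

(** * Inequalities between eigenvalue, trace, exponential and capacity *)

Section gram_bounds.
Context (R : realType) (n m : nat).
Implicit Types H : 'M[R[i]]_(n, m).

Lemma lambda_max_gram_ge0 H : 0 <= lambda_max (gram H).
Proof.
have [U [d [d0 UdG]]] := gram_diagonalizable H.
exact: (lambda_max_ge0 UdG d0).
Qed.

Lemma lambda_max_gram_le H : lambda_max (gram H) <= retr (gram H).
Proof.
have [U [d [d0 UdG]]] := gram_diagonalizable H.
exact: (lambda_max_le_retr UdG d0).
Qed.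

Lemma retr_gram_ge0 H : 0 <= retr (gram H).
Proof. exact: le_trans (lambda_max_gram_ge0 H) (lambda_max_gram_le H). Qed.

(* [n.+1] rather than [n] keeps the constant positive when [n = 0]. *)
Lemma retr_gram_le H : retr (gram H) <= n.+1%:R * lambda_max (gram H).
Proof.
have [U [d [d0 UdG]]] := gram_diagonalizable H.
apply: le_trans (retr_le_lambda_max UdG d0) _.
by rewrite ler_wpM2r ?ler_nat// lambda_max_gram_ge0.
Qed.

Lemma retr1D H (s : R) :
  retr (1%:M + s%:C%C *: gram H) = n%:R + s * retr (gram H).
Proof.
rewrite /retr mxtraceD mxtrace1 mxtraceZ.
case: (\tr (gram H)) => a b /=; rewrite -(rmorph_nat (real_complex R)) /=.
by rewrite mul0r subr0.
Qed.

(** This is [1 + x <= expR x], summed over the eigenvalues. *)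
Lemma retr1D_le_mxexp H (s : R) :
  retr (1%:M + s%:C%C *: gram H) <= retr (mxexp (s%:C%C *: gram H)).
Proof.
have [U [d [d0 UdG]]] := gram_diagonalizable H.
rewrite retr1D (retr_diagonalizes UdG) mulr_sumr.
rewrite (retr_diagonalizes (diagonalizes_mxexp (diagonalizes_scale s UdG))).
rewrite -[X in X%:R]card_ord -sumr_const -big_split/=.
by apply: ler_sum => i _; exact: expR_ge1Dx.
Qed.

(** The maximum eigenvalue is attained, so the left side is one of the nonnegative terms of the
    trace. For [n = 0] the left side would be 1 and the trace 0. *)
Lemma expR_lambda_max_le H (s : R) : (0 < n)%N ->
  expR (s * lambda_max (gram H)) <= retr (mxexp (s%:C%C *: gram H)).
Proof.
move=> n0; have [U [d [d0 UdG]]] := gram_diagonalizable H.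
have [i ->] := lambda_max_eigenvalue UdG d0 n0.
rewrite (retr_diagonalizes (diagonalizes_mxexp (diagonalizes_scale s UdG))).
by rewrite (bigD1 i)//= lerDl sumr_ge0// => j _; rewrite expR_ge0.
Qed.

Lemma capacity_le W N0 (p : R) H : 0 < W -> 0 < N0 -> 0 <= p ->
  capacity W N0 H p <=
    W * n.+1%:R / ln 2 * ln (1 + p / (m%:R * N0 * W) * retr (gram H)).
Proof.
move=> W0 N00 p0; rewrite /capacity /log2.
have ln20 : 0 < ln 2 :> R by rewrite ln_gt0// ltr1n.
(* When [m = 0] this quotient is 0, as division by zero yields 0. *)
have s0 : 0 <= p / (m%:R * N0 * W) by rewrite divr_ge0// !mulr_ge0// ltW.
move: (p / _) s0 => s s0.
rewrite -!mulrA ler_pM2l// mulrCA [X in X <= _]mulrC ler_pM2l ?invr_gt0//.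
have [U [d [d0 UdG]]] := gram_diagonalizable H.
rewrite (det1D_diagonalizes (diagonalizes_scale s UdG)) (retr_diagonalizes UdG).
have tr0 : 0 <= s * \sum_i d i by rewrite mulr_ge0// sumr_ge0.
have S1 : 1 <= 1 + s * \sum_i d i by rewrite lerDl.
have S0 := lt_le_trans ltr01 S1.
rewrite mulr_natl -lnXn// ler_ln ?posrE ?exprn_gt0//; last first.
  by apply: prodr_gt0 => i _; rewrite ltr_wpDr// mulr_ge0.
(* The exponent [n.+1] costs one more factor that is at least 1; it keeps the constant in front of
   the logarithm positive when [n = 0]. *)
apply: (@le_trans _ _ ((1 + s * \sum_i d i) ^+ n)); last first.
  by rewrite exprS ler_peMl// exprn_ge0// ltW.
rewrite -[X in _ ^+ X]card_ord -prodr_const; apply: ler_prod => i _.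
rewrite addr_ge0 ?mulr_ge0//= lerD2l ler_wpM2l// (bigD1 i)//= lerDl.
exact: sumr_ge0.
Qed.

End gram_bounds.

(** * Scalar power inequalities and the implications between the conditions *)

Lemma powR_1D_le_expR (R : realType) (x r : R) : 0 <= x -> 0 <= r ->
  (1 + x) `^ r <= expR (r * x).
Proof.
move=> x0 r0; have x1 : 0 < 1 + x by rewrite ltr_wpDr.
rewrite /powR gt_eqF// ler_expR ler_wpM2l// -[leRHS]expRK ler_ln ?posrE ?expR_gt0//.
exact: expR_ge1Dx.
Qed.

Lemma powR_max1_le (R : realType) (x r : R) : 0 <= x ->
  Num.max 1 x `^ r <= 1 + x `^ r.
Proof.
move=> x0; rewrite /Num.max; case: ifP => _; first by rewrite lerDr.
by rewrite powR1 lerDl powR_ge0.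
Qed.

Lemma retr_dim0 (R : realType) n (A : 'M[R[i]]_n) : n = 0%N -> retr A = 0.
Proof. by move=> n0; subst n; rewrite /retr /mxtrace big_ord0. Qed.

Theorem theorem6 (R : realType) (d : measure_display) (T : measurableType d)
  (P : probability T R) (NR NT : nat) (W N0 : R)
  (H : T -> 'M[R[i]]_(NR, NT)) (p : T -> R) :
  0 < W -> 0 < N0 ->
  (forall (i : 'I_NR) (j : 'I_NT),
     measurable_fun setT (fun t => complex.Re (H t i j)) /\
     measurable_fun setT (fun t => complex.Im (H t i j))) ->
  measurable_fun setT p ->
  (forall t, 0 <= p t) ->
  let G := fun t => gram (H t) in
  let lam := fun t => lambda_max (G t) in
  let c := fun t => capacity W N0 (H t) (p t) in
  let cond0 := exists theta : R, 0 < theta /\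
      finite_mean P (fun t => (1 + p t * lam t) `^ theta) in
  let cond1 := exists theta : R, 0 < theta /\
      finite_mean P (fun t => (1 + p t * retr (G t)) `^ theta) in
  let cond2 := exists theta : R, 0 < theta /\
      finite_mean P (fun t => (retr (1%:M + ((p t)%:C)%C *: G t)) `^ theta) in
  let cond3 := exists theta : R, 0 < theta /\
      finite_mean P (fun t => (retr (mxexp (((p t)%:C)%C *: G t))) `^ theta) in
  let cond4 := exists theta : R, 0 < theta /\
      finite_mean P (fun t => expR (theta * p t * lam t)) in
  let cond5 := exists theta : R, 0 < theta /\
      finite_mean P (fun t => retr (mxexp (((theta * p t)%:C)%C *: G t))) in
  let cond6 := exists theta : R, 0 < theta /\
      finite_mean P (fun t => (p t * lam t) `^ theta) in
  let cond7 := exists theta : R, 0 < theta /\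
      finite_mean P (fun t => expR (theta * p t * retr (G t))) in
  ((cond0 <-> cond1) /\ (cond2 -> cond1) /\ (cond3 -> cond2) /\
   (cond4 -> cond1) /\ (cond5 -> cond4) /\ (cond0 <-> cond6) /\
   (cond4 <-> cond7)) /\
  ((cond0 -> light_tailed P c) /\ (cond1 -> light_tailed P c) /\
   (cond2 -> light_tailed P c) /\ (cond3 -> light_tailed P c) /\
   (cond4 -> light_tailed P c) /\ (cond5 -> light_tailed P c) /\
   (cond6 -> light_tailed P c) /\ (cond7 -> light_tailed P c)).
Proof.
move=> W0 N00 mH mp p0 G lam c c0 c1 c2 c3 c4 c5 c6 c7.
have lam0 t : 0 <= lam t by exact: lambda_max_gram_ge0.
have lamtr t : lam t <= retr (G t) by exact: lambda_max_gram_le.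
have tr0 t : 0 <= retr (G t) by exact: retr_gram_ge0.
have trlam t : retr (G t) <= NR.+1%:R * lam t by exact: retr_gram_le.
have plam0 t : 0 <= p t * lam t by rewrite mulr_ge0.
have ptr0 t : 0 <= p t * retr (G t) by rewrite mulr_ge0.
have plamtr t : p t * lam t <= p t * retr (G t) by rewrite ler_wpM2l.
have ptrlam t : p t * retr (G t) <= NR.+1%:R * (p t * lam t).
  by rewrite mulrCA ler_wpM2l.
have n1 : 1 <= NR.+1%:R :> R by rewrite ler1n.
have n0 : 0 < NR.+1%:R :> R by rewrite ltr0n.
have mtr : measurable_fun setT (fun t => p t * retr (G t)).
  apply: measurable_funM => //; apply: measurable_retr; exact: cmeasurable_gram.
have mtr1 theta : measurable_fun setT (fun t => (1 + p t * retr (G t)) `^ theta).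
  apply: (measurableT_comp (measurable_powR _)) => //.
  by apply: measurable_funD.
have c01 : c0 -> c1.
  move=> [theta [th0 fin]]; exists theta; split; first exact: th0.
  (* The constant comes from [1 + p Tr G <= NR.+1 * (1 + p lam)], raised to the power [theta]. *)
  apply: (finite_mean_le_affine (mtr1 theta)
    (powR_ge0 NR.+1%:R theta) (lexx 0) _ _ fin) => t; first exact: powR_ge0.
  rewrite powR_ge0 addr0 -powRM ?addr_ge0//=; apply: ge0_ler_powR.
  - exact: ltW.
  - by rewrite nnegrE addr_ge0.
  - by rewrite nnegrE mulr_ge0 ?addr_ge0.
  - by rewrite mulrDr mulr1 lerD.
have c10 : c1 -> c0.
  move=> [theta [th0 fin]]; exists theta; split; first exact: th0.
  apply: finite_mean_le fin => t; rewrite powR_ge0/=; apply: ge0_ler_powR.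
  - exact: ltW.
  - by rewrite nnegrE addr_ge0.
  - by rewrite nnegrE addr_ge0.
  - by rewrite lerD2l.
have c06 : c0 -> c6.
  move=> [theta [th0 fin]]; exists theta; split; first exact: th0.
  apply: finite_mean_le fin => t; rewrite powR_ge0/=; apply: ge0_ler_powR.
  - exact: ltW.
  - by rewrite nnegrE.
  - by rewrite nnegrE addr_ge0.
  - by rewrite lerDr.
have c61 : c6 -> c1.
  move=> [theta [th0 fin]]; exists theta; split; first exact: th0.
  (* Here [1 + p Tr G <= (1 + NR.+1) * max 1 (p lam)]. The power of the maximum is at most
     [1 + (p lam) ^ theta], so the same constant serves as slope and as offset. *)
  have k0 := powR_ge0 (1 + NR.+1%:R : R) theta.
  apply: (finite_mean_le_affine (mtr1 theta) k0 k0 _ _ fin) => t.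
    exact: powR_ge0.
  rewrite powR_ge0/= -[X in _ <= _ + X]mulr1 -mulrDr.
  apply: (@le_trans _ _ ((1 + NR.+1%:R) `^ theta * Num.max 1 (p t * lam t) `^ theta)).
    have max0 : 0 <= Num.max 1 (p t * lam t) by rewrite le_max ler01.
    rewrite -powRM ?addr_ge0//; apply: ge0_ler_powR.
    - exact: ltW.
    - by rewrite nnegrE addr_ge0.
    - by rewrite nnegrE mulr_ge0 ?addr_ge0.
    - rewrite mulrDl mul1r lerD ?le_max ?lexx//.
      by apply: le_trans (ptrlam t) _; rewrite ler_wpM2l ?le_max ?lexx ?orbT.
  by rewrite ler_wpM2l// addrC powR_max1_le.
have c21 : c2 -> c1.
  move=> [theta [th0 fin]]; exists theta; split; first exact: th0.
  apply: (finite_mean_le_affine (mtr1 theta) ler01 ler01 _ _ fin) => t.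
    exact: powR_ge0.
  (* For [NR = 0] the trace in (2) vanishes while the function in (1) equals 1; the offset 1 absorbs
     this. Otherwise [1 <= NR] gives the comparison. *)
  rewrite powR_ge0 mul1r retr1D -/(G t)/=; case: (posnP NR) => [NR0|NRgt0].
    rewrite (retr_dim0 _ NR0).
    by rewrite mulr0 addr0 powR1 lerDr powR_ge0.
  rewrite -[leLHS]addr0 lerD ?ler01//; apply: ge0_ler_powR.
  - exact: ltW.
  - by rewrite nnegrE addr_ge0.
  - by rewrite nnegrE addr_ge0.
  - by rewrite lerD2r ler1n.
have c32 : c3 -> c2.
  move=> [theta [th0 fin]]; exists theta; split; first exact: th0.
  have le t := retr1D_le_mxexp (H t) (p t).
  have ge0 t : 0 <= retr (1%:M + ((p t)%:C)%C *: G t) by rewrite retr1D addr_ge0.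
  apply: finite_mean_le fin => t; rewrite powR_ge0/=; apply: ge0_ler_powR => //.
  - exact: ltW.
  - by rewrite nnegrE.
  - by rewrite nnegrE; exact: le_trans (le t).
have c47 : c4 -> c7.
  move=> [theta [th0 fin]]; exists (theta / NR.+1%:R).
  split; first by rewrite divr_gt0.
  apply: finite_mean_le fin => t; rewrite expR_ge0 ler_expR/= -!mulrA.
  by rewrite ler_pM2l// ler_pdivrMl// ptrlam.
have c74 : c7 -> c4.
  move=> [theta [th0 fin]]; exists theta; split; first exact: th0.
  apply: finite_mean_le fin => t; rewrite expR_ge0 ler_expR/= -!mulrA.
  by rewrite ler_pM2l// plamtr.
have c71 : c7 -> c1.
  move=> [theta [th0 fin]]; exists theta; split; first exact: th0.
  apply: finite_mean_le fin => t; rewrite powR_ge0/= -mulrA.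
  by apply: powR_1D_le_expR => //; exact: ltW.
(* Condition (5) reaches (4) through (7): for [NR = 0] the trace of the exponential is 0 and an
   offset is required, hence a measurable function to compare, which the exponential of the trace
   is. *)
have c57 : c5 -> c7.
  move=> [theta [th0 fin]]; exists (theta / NR.+1%:R).
  split; first by rewrite divr_gt0.
  have exp_ge0 t : 0 <= retr (mxexp (((theta * p t)%:C)%C *: G t)).
    apply: le_trans (retr1D_le_mxexp _ _).
    by rewrite retr1D addr_ge0// -mulrA mulr_ge0// ltW.
  apply: (finite_mean_le_affine _ ler01 ler01 exp_ge0 _ fin).
    apply: measurableT_comp => //; under eq_fun do rewrite -mulrA.
    exact: measurable_funM.
  move=> t; rewrite expR_ge0 mul1r/=; case: (posnP NR) => [NR0|NRgt0].
    rewrite (retr_dim0 _ NR0).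
    by rewrite mulr0 expR0 lerDr.
  rewrite -[leLHS]addr0 lerD ?ler01//.
  apply: le_trans (expR_lambda_max_le (H t) (theta * p t) NRgt0).
  by rewrite ler_expR -!mulrA ler_pM2l// ler_pdivrMl.
have light : c1 -> light_tailed P c.
  move=> [theta [th0 fin]].
  have ln20 : 0 < ln 2 :> R by rewrite ln_gt0// ltr1n.
  pose K := W * NR.+1%:R / ln 2.
  have K0 : 0 < K by rewrite divr_gt0// mulr_gt0.
  pose s := (NT%:R * N0 * W)^-1.
  have s0 : 0 <= s by rewrite invr_ge0 !mulr_ge0// ltW.
  have mc : measurable_fun setT c by exact: measurable_capacity.
  (* [K] is the factor of the logarithm in [capacity_le], so [theta / K] turns the exponential of
     [c] into a power with exponent [theta]. Its base [1 + s * p Tr G] is at most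
     [(1 + s) * (1 + p Tr G)]. *)
  apply: (@light_tailed_of_mgf _ _ _ P c (theta / K)) => //.
    by rewrite divr_gt0.
  apply: (finite_mean_le_affine _ (powR_ge0 (1 + s) theta) (lexx 0) _ _ fin).
  - by apply: measurableT_comp => //; exact: measurable_funM.
  - by move=> t; exact: powR_ge0.
  move=> t; rewrite expR_ge0 addr0/= -powRM ?addr_ge0//.
  have y0 : 0 < (1 + s) * (1 + p t * retr (G t)) by rewrite mulr_gt0// ltr_wpDr.
  rewrite /powR gt_eqF// ler_expR -mulrA ler_pM2l// ler_pdivrMl//.
  apply: le_trans (capacity_le (H t) W0 N00 (p0 t)) _.
  rewrite -/K -/(G t) ler_pM2l// -/s.
  have z0 : 0 <= p t * s * retr (G t) by rewrite !mulr_ge0.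
  rewrite ler_ln ?posrE ?ltr_wpDr//.
  rewrite mulrDl mul1r mulrDr mulr1 -addrA lerD2l mulrAC [_ * s]mulrC.
  by rewrite addrCA addrA lerDr addr_ge0.
(* Without this, [done] tries to convert one condition into another. *)
clearbody c0 c1 c2 c3 c4 c5 c6 c7.
have c41 : c4 -> c1 by move=> /c47.
have c51 : c5 -> c1 by move=> /c57.
have c31 : c3 -> c1 by move=> /c32.
(* Two implications are composites: (5) to (4) through (7), and (6) to (0) through (1). Light tails
   always follow from (1). *)
split; first by do !split=> //; [move/c57 | move/c61].
by do !split=> //;
  [move/c01 | move/c21 | move/c31 | move/c41 | move/c51 | move/c61 | move/c71].
Qed.
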